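(* Let $J:\mathfrak{su}(2)\oplus\mathfrak{su}(2)\to\mathfrak{su}(2)\oplus\mathfrak{su}(2)$ be an $\mathbb{R}$-linear map. Then $J$ has zero torsion if and only if there exist $\Phi\in SO(3)\times SO(3)$ and $\xi^3_3,\xi^3_6,\xi^6_3,\xi^6_6\in\mathbb{R}$ such that $$\Phi^{-1}J\Phi=\begin{pmatrix} 0&1&0&0&0&0\\ -1&0&0&0&0&0\\ 0&0&\xi^3_3&0&0&\xi^3_6\\ 0&0&0&0&1&0\\ 0&0&0&-1&0&0\\ 0&0&\xi^6_3&0&0&\xi^6_6 \end{pmatrix}.$$
   Context: $\mathfrak{su}(2)\oplus\mathfrak{su}(2)$ has basis $(J^{(1)}_1,J^{(1)}_2,J^{(1)}_3,J^{(2)}_1,J^{(2)}_2,J^{(2)}_3)$, where for each $k=1,2$: $[J^{(k)}_1,J^{(k)}_2]=J^{(k)}_3$, $[J^{(k)}_2,J^{(k)}_3]=J^{(k)}_1$, $[J^{(k)}_3,J^{(k)}_1]=J^{(k)}_2$, and brackets between different factors vanish. Linear maps are identified with their matrices in this basis (columns are images of basis vectors). $SO(3)\times SO(3)$ denotes the group of block-diagonal matrices $\mathrm{diag}(\Phi_1,\Phi_2)$ with $\Phi_1,\Phi_2\in SO(3)$. A linear map $J:\mathfrak{g}\to\mathfrak{g}$ on a real Lie algebra (not necessarily with $J^2=-1$) has zero torsion if $[JX,JY]-[X,Y]-J[JX,Y]-J[X,JY]=0$ for all $X,Y\in\mathfrak{g}$. *)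

(* Defs.v *)
From mathcomp Require Import all_boot all_order all_algebra.
From mathcomp Require Import reals.
From mathcomp Require Import ring.

Set Implicit Arguments.
Unset Strict Implicit.
Unset Printing Implicit Defensive.

Import Order.TTheory GRing.Theory Num.Theory.
Local Open Scope ring_scope.

(* [J] need not satisfy J^2 = -1. *)
Definition zero_torsion (V : zmodType) (br : V -> V -> V) (J : V -> V) : Prop :=
  forall X Y : V,
    br (J X) (J Y) - br X Y - J (br (J X) Y) - J (br X (J Y)) = 0.

(* su(2) in coordinates on a basis with [J_1,J_2] = J_3 and cyclic
   permutations, i.e. R^3 with the cross product.  Indices are in 'I_3, so
   i + 1 and i + 2 are computed modulo 3. *)
Definition su2_bracket (R : realType) (x y : 'cV[R]_3) : 'cV[R]_3 :=
  \col_(i < 3) (x (i + 1) 0 * y (i + 2) 0 - x (i + 2) 0 * y (i + 1) 0).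

(* Coordinates are ordered J^(1)_1, J^(1)_2, J^(1)_3, J^(2)_1, J^(2)_2, J^(2)_3. *)
Notation su2su2 R := 'cV[R]_(3 + 3).

Definition bracket (R : realType) (x y : su2su2 R) : su2su2 R :=
  col_mx (su2_bracket (usubmx x) (usubmx y)) (su2_bracket (dsubmx x) (dsubmx y)).

Definition basis (R : realType) (j : 'I_(3 + 3)) : su2su2 R := delta_mx j 0.

(* Column convention: column j holds the coordinates of f (basis j).  The
   library's [lin1_mx] is the transposed convention, for row vectors. *)
Definition matrix_of (R : realType) (f : su2su2 R -> su2su2 R) : 'M[R]_(3 + 3) :=
  \matrix_(i, j) f (basis R j) i 0.

Definition is_SO (R : realType) (n : nat) (A : 'M[R]_n) : Prop :=
  A^T *m A = 1%:M /\ \det A = 1.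

Definition is_SO3xSO3 (R : realType) (Phi : 'M[R]_(3 + 3)) : Prop :=
  exists Phi1 Phi2 : 'M[R]_3,
    [/\ is_SO Phi1, is_SO Phi2 & Phi = block_mx Phi1 0 0 Phi2].

(* [xi_ij] is the entry in row i, column j, counted from 1. *)
Definition normal_form (R : realType) (xi_33 xi_36 xi_63 xi_66 : R) :
    'M[R]_(3 + 3) :=
  \matrix_(i < 3 + 3, j < 3 + 3)
    (nth [::]
      [:: [::  0; 1;     0;  0; 0;     0];
          [:: -1; 0;     0;  0; 0;     0];
          [::  0; 0; xi_33;  0; 0; xi_36];
          [::  0; 0;     0;  0; 1;     0];
          [::  0; 0;     0; -1; 0;     0];
          [::  0; 0; xi_63;  0; 0; xi_66]] i)`_j.

Section Facts.
Variable R : realType.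
Implicit Types x y z : su2su2 R.

Lemma su2_bracket_basis (i : 'I_3) :
  su2_bracket (delta_mx i 0) (delta_mx (i + 1) 0) = delta_mx (i + 2) 0 :> 'cV[R]_3.
Proof.
apply/matrixP=> k j; rewrite ord1 !mxE.
case: i => [[|[|[|//]]] ?]; case: k => [[|[|[|//]]] ?];
  rewrite -!val_eqE /=; ring.
Qed.

Lemma su2_bracketZDl a (x y z : 'cV[R]_3) :
  su2_bracket (a *: x + y) z = a *: su2_bracket x z + su2_bracket y z.
Proof. by apply/matrixP=> k j; rewrite !mxE; ring. Qed.

Lemma su2_bracketC (x y : 'cV[R]_3) : su2_bracket x y = - su2_bracket y x.
Proof. by apply/matrixP=> k j; rewrite !mxE; ring. Qed.

Lemma su2_bracketxx (x : 'cV[R]_3) : su2_bracket x x = 0.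
Proof. by apply/matrixP=> k j; rewrite !mxE; ring. Qed.

Lemma su2_bracket_jacobi (x y z : 'cV[R]_3) :
  su2_bracket x (su2_bracket y z) + su2_bracket y (su2_bracket z x)
    + su2_bracket z (su2_bracket x y) = 0.
Proof.
apply/matrixP=> k j; rewrite !mxE.
have E1 : k + 1 + 1 = k + 2 by rewrite -addrA.
have E2 : k + 1 + 2 = k.
  by apply: val_inj; case: k {E1} => [[|[|[|//]]] ?].
have E3 : k + 2 + 1 = k by rewrite -addrA (addrC 2) addrA.
have E4 : k + 2 + 2 = k + 1.
  by apply: val_inj; case: k {E1 E2 E3} => [[|[|[|//]]] ?].
by rewrite E1 E2 E3 E4; ring.
Qed.

Lemma su2_bracket0x (x : 'cV[R]_3) : su2_bracket 0 x = 0.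
Proof. by apply/matrixP=> k j; rewrite !mxE; ring. Qed.

Lemma bracketZDl a x y z : bracket (a *: x + y) z = a *: bracket x z + bracket y z.
Proof.
rewrite /bracket [usubmx _]linearP [dsubmx _]linearP !su2_bracketZDl.
by rewrite -add_col_mx -scale_col_mx.
Qed.

Lemma bracketC x y : bracket x y = - bracket y x.
Proof.
by rewrite /bracket su2_bracketC (su2_bracketC (dsubmx x)) -opp_col_mx.
Qed.

Lemma bracketxx x : bracket x x = 0.
Proof. by rewrite /bracket !su2_bracketxx col_mx0. Qed.

Lemma bracket_jacobi x y z :
  bracket x (bracket y z) + bracket y (bracket z x) + bracket z (bracket x y) = 0.
Proof.
rewrite /bracket !col_mxKu !col_mxKd.
by rewrite !add_col_mx !su2_bracket_jacobi col_mx0.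
Qed.

Lemma basis_lshift (i : 'I_3) : basis R (lshift 3 i) = col_mx (delta_mx i 0) 0.
Proof. exact: delta_mx_ushift. Qed.

Lemma basis_rshift (i : 'I_3) : basis R (rshift 3 i) = col_mx 0 (delta_mx i 0).
Proof. exact: delta_mx_dshift. Qed.

Lemma bracket_basis1 (i : 'I_3) :
  bracket (basis R (lshift 3 i)) (basis R (lshift 3 (i + 1)))
    = basis R (lshift 3 (i + 2)).
Proof.
by rewrite !basis_lshift /bracket !col_mxKu !col_mxKd su2_bracket_basis su2_bracket0x.
Qed.

Lemma bracket_basis2 (i : 'I_3) :
  bracket (basis R (rshift 3 i)) (basis R (rshift 3 (i + 1)))
    = basis R (rshift 3 (i + 2)).
Proof.
by rewrite !basis_rshift /bracket !col_mxKu !col_mxKd su2_bracket_basis su2_bracket0x.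
Qed.

Lemma bracket_basis12 (i j : 'I_3) :
  bracket (basis R (lshift 3 i)) (basis R (rshift 3 j)) = 0.
Proof.
rewrite basis_lshift basis_rshift /bracket !col_mxKu !col_mxKd.
by rewrite su2_bracketC !su2_bracket0x oppr0 col_mx0.
Qed.

End Facts.

(* Main.v *)
Require Import Defs.
From mathcomp Require Import all_boot all_order all_algebra.
From mathcomp Require Import reals.
From mathcomp Require Import ring lra.

(* Write J in 3x3 blocks A, B, C, D.  Torsion freeness makes the diagonal blocks
   A and D torsion free on su(2), and cofactor identities together with
   Cayley-Hamilton force A = t v v^T - [v]_x with |v| = 1 (and D likewise), where
   [v]_x is the matrix of the cross product by v.  Rotations taking e3 to these
   axes preserve the bracket and put both diagonal blocks in normal form.  The
   remaining torsion equations then say that the columns c1, c2 of C satisfy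
   c1 x c2 = 0, c1 x c3 = - c1 - t c2, c2 x c3 = - c2 + t c1, so that
   c1 = c2 = 0, and next that B takes values in the third axis; exchanging the
   two factors finishes the off-diagonal blocks. *)

Set Implicit Arguments.
Unset Strict Implicit.
Unset Printing Implicit Defensive.

Import Order.TTheory GRing.Theory Num.Theory.
Local Open Scope ring_scope.

(** * Coordinates and determinants in dimension three *)

Lemma sum_ord3 (V : nmodType) (F : 'I_3 -> V) : \sum_i F i = F 0 + F 1 + F 2.
Proof.
by rewrite !big_ord_recl big_ord0 addr0 addrA; congr (F _ + F _ + F _); apply: val_inj.
Qed.

Lemma ord3P (P : 'I_3 -> Prop) : P 0 -> P 1 -> P 2 -> forall i, P i.
Proof.
move=> P0 P1 P2 [[|[|[|//]]] lti].
- by rewrite (_ : Ordinal lti = 0) //; apply: val_inj.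
- by rewrite (_ : Ordinal lti = 1) //; apply: val_inj.
- by rewrite (_ : Ordinal lti = 2) //; apply: val_inj.
Qed.

Lemma ord3D : (0 + 1 = 1 :> 'I_3) * (0 + 2 = 2 :> 'I_3) * (1 + 1 = 2 :> 'I_3) *
  (1 + 2 = 0 :> 'I_3) * (2 + 1 = 0 :> 'I_3) * (2 + 2 = 1 :> 'I_3).
Proof. by do !split; apply: val_inj. Qed.

Lemma col3P (T : Type) (x y : 'cV[T]_3) :
  x 0 0 = y 0 0 -> x 1 0 = y 1 0 -> x 2 0 = y 2 0 -> x = y.
Proof. by move=> *; apply/colP; apply: ord3P. Qed.

Lemma mat3P (T : Type) (A B : 'M[T]_3) :
  (forall i, [/\ A i 0 = B i 0, A i 1 = B i 1 & A i 2 = B i 2]) -> A = B.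
Proof. by move=> AB; apply/matrixP=> i; apply: ord3P; case: (AB i). Qed.

Lemma det3 (R : comNzRingType) (A : 'M[R]_3) :
  \det A = A 0 0 * (A 1 1 * A 2 2 - A 1 2 * A 2 1)
         - A 0 1 * (A 1 0 * A 2 2 - A 1 2 * A 2 0)
         + A 0 2 * (A 1 0 * A 2 1 - A 1 1 * A 2 0).
Proof.
rewrite (expand_det_row _ 0) sum_ord3 /cofactor.
rewrite !(expand_det_row _ ord0) !big_ord_recl !big_ord0 /cofactor !det_mx11 !mxE /=.
(* The expansion writes the same index in several forms; reading entries through natural numbers
   lets [ring] identify them. *)
pose a m n := A (inord m) (inord n).
have aE i j : A i j = a i j by rewrite /a !inord_val.
by rewrite !{}aE /= /bump /= !(modn_small (isT : 1 < 3)%N); ring.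
Qed.

(** * Rotations and the cross product *)

Section NormalForm.
Variable R : realType.
Implicit Types (A B C D : 'M[R]_3) (M Phi : 'M[R]_(3 + 3)) (x y : 'cV[R]_3).

Definition mat3 (a b c d e f g h k : R) : 'M[R]_3 :=
  \matrix_(i < 3, j < 3) (nth [::] [:: [:: a; b; c]; [:: d; e; f]; [:: g; h; k]] i)`_j.

Definition col3 (a b c : R) : 'cV[R]_3 := \col_(i < 3) [:: a; b; c]`_i.

(** The cross product of [A x] and [A y] is the cofactor matrix of [A] applied to that of [x] and
    [y], and [A^T] times the cofactor matrix is [\det A]. *)
Lemma trmx_mul_su2_bracket A x y :
  A^T *m su2_bracket (A *m x) (A *m y) = \det A *: su2_bracket x y.
Proof.
apply: col3P; rewrite !(mxE, sum_ord3, ord3D) det3; ring.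
Qed.

Lemma SO_mul_tr A : is_SO A -> A *m A^T = 1%:M.
Proof. by case=> /mulmx1C. Qed.

Lemma SO_su2_bracket A x y :
  is_SO A -> su2_bracket (A *m x) (A *m y) = A *m su2_bracket x y.
Proof.
move=> SA; have := congr1 (mulmx A) (trmx_mul_su2_bracket A x y).
by rewrite mulmxA SO_mul_tr // mul1mx SA.2 scale1r.
Qed.

Lemma SO_of_unit_vector (x y z : R) : x ^+ 2 + y ^+ 2 + z ^+ 2 = 1 ->
  exists2 Phi : 'M[R]_3, is_SO Phi & Phi *m delta_mx 2 0 = col3 x y z.
Proof.
(* The general formula divides by [1 + z]; at the antipode of [e3] the half-turn about the first
   axis serves instead. *)
move=> v1; have [z1|z1] := eqVneq (1 + z) 0.
  have {z1} zE : z = -1 by lra.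
  have [xE yE] : x = 0 /\ y = 0 by split; apply/eqP; rewrite -sqrf_eq0; apply/eqP; nra.
  exists (mat3 1 0 0 0 (-1) 0 0 0 (-1)).
    split; last by rewrite det3 !mxE /=; ring.
    by apply: mat3P; apply: ord3P; split; rewrite !(mxE, sum_ord3) /=; ring.
  by apply: col3P; rewrite !(mxE, sum_ord3) /= ?xE ?yE ?zE; ring.
(* The rotation of least angle taking [e3] to [(x, y, z)]. *)
set w := (1 + z)^-1.
have wE : w * (1 + z) = 1 by rewrite mulVf.
have xy : x ^+ 2 + y ^+ 2 = (1 + z) * (1 - z) by lra.
have wxy : w * (x ^+ 2 + y ^+ 2) = 1 - z by rewrite xy mulrA wE mul1r.
exists (mat3 (1 - w * x ^+ 2) (- w * x * y) x
             (- w * x * y) (1 - w * y ^+ 2) y (- x) (- y) z).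
  split; last first.
    rewrite det3 !mxE /=.
    have := congr1 ( *%R z) wxy; have := congr1 ( *%R (x ^+ 2 + y ^+ 2)) wE; nra.
  (* These multiples of [wxy] and [wE] make orthogonality a matter of linear arithmetic. *)
  have h1 := congr1 ( *%R (w * x ^+ 2)) wxy; have h2 := congr1 ( *%R (w * y ^+ 2)) wxy.
  have h3 := congr1 ( *%R (w * x * y)) wxy; have h4 := congr1 ( *%R (x ^+ 2)) wE.
  have h5 := congr1 ( *%R (y ^+ 2)) wE; have h6 := congr1 ( *%R (x * y)) wE.
  have h7 := congr1 ( *%R x) wxy; have h8 := congr1 ( *%R y) wxy.
  by apply: mat3P; apply: ord3P; split; rewrite !(mxE, sum_ord3) /=; lra.
by apply: col3P; rewrite !(mxE, sum_ord3) /=; ring.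
Qed.

(** * Calculus of explicit vectors and matrices *)

Lemma mul_mat3_col3 (a b c d e f g h k x y z : R) :
  mat3 a b c d e f g h k *m col3 x y z =
  col3 (a * x + b * y + c * z) (d * x + e * y + f * z) (g * x + h * y + k * z).
Proof. by apply: col3P; rewrite !(mxE, sum_ord3). Qed.

Lemma su2_bracket_col3 (a b c x y z : R) :
  su2_bracket (col3 a b c) (col3 x y z) =
  col3 (b * z - c * y) (c * x - a * z) (a * y - b * x).
Proof. by apply: col3P; rewrite !(mxE, ord3D). Qed.

Lemma col3B (a b c x y z : R) :
  col3 a b c - col3 x y z = col3 (a - x) (b - y) (c - z).
Proof. by apply: col3P; rewrite !mxE. Qed.

Lemma col3_eta x : x = col3 (x 0 0) (x 1 0) (x 2 0).
Proof. by apply: col3P; rewrite mxE. Qed.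

Lemma mat3_eta A :
  A = mat3 (A 0 0) (A 0 1) (A 0 2) (A 1 0) (A 1 1) (A 1 2) (A 2 0) (A 2 1) (A 2 2).
Proof. by apply: mat3P; apply: ord3P; split; rewrite mxE. Qed.

Lemma col3D (a b c x y z : R) :
  col3 a b c + col3 x y z = col3 (a + x) (b + y) (c + z).
Proof. by apply: col3P; rewrite !mxE. Qed.

Lemma col3_inj (a b c x y z : R) :
  col3 a b c = col3 x y z -> [/\ a = x, b = y & c = z].
Proof. by move/colP=> E; split; [have := E 0|have := E 1|have := E 2]; rewrite !mxE. Qed.

Lemma col3_0 : 0 = col3 0 0 0 :> 'cV[R]_3.
Proof. by apply: col3P; rewrite !mxE. Qed.

Lemma col3_eq0 (x y z : R) : col3 x y z = 0 -> [/\ x = 0, y = 0 & z = 0].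
Proof. by rewrite col3_0 => /col3_inj. Qed.

(** * Torsion-free maps of su(2) *)

Lemma symmetric_norm_eq0 (a b c d e f : R) :
  a ^+ 2 + b ^+ 2 + c ^+ 2 + 2 * (d ^+ 2 + e ^+ 2 + f ^+ 2) = 0 ->
  [/\ a = 0, b = 0 & c = 0] /\ [/\ d = 0, e = 0 & f = 0].
Proof.
move=> E; have sq0 (x : R) : x ^+ 2 <= 0 -> x = 0.
  by move=> x0; apply/eqP; rewrite -sqrf_eq0 eq_le x0 sqr_ge0.
have := (sqr_ge0 a, sqr_ge0 b, sqr_ge0 c, (sqr_ge0 d, sqr_ge0 e, sqr_ge0 f)).
move=> -[[[a0 b0] c0] [[d0 e0] f0]].
by do !split; apply: sq0; lra.
Qed.

(* [A = S + K] with [S] symmetric and [K x = - (v * x)], where [*] is the cross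
   product.  As [A x * A y] is the cofactor matrix of [A] applied to [x * y],
   and [A x * y + x * A y = (t - A^T) (x * y)] with [t] the trace, torsion
   freeness reads [adj A = 1 + t A^T - A A^T]; since
   [adj A = A^2 - t A + s2], this is [(A - t) S = c] with [c = (1 - s2) / 2]. *)
Lemma sym_antisym_eq (s11 s22 s33 s12 s13 s23 v1 v2 v3 : R) :
  let t := s11 + s22 + s33 in
  let c := (1 - (s11 * s22 + s11 * s33 + s22 * s33 - s12 ^+ 2 - s13 ^+ 2 - s23 ^+ 2)
              - (v1 ^+ 2 + v2 ^+ 2 + v3 ^+ 2)) / 2 in
  mat3 (s11 - t) (s12 + v3) (s13 - v2) (s12 - v3) (s22 - t) (s23 + v1)
       (s13 + v2) (s23 - v1) (s33 - t)
    *m mat3 s11 s12 s13 s12 s22 s23 s13 s23 s33 = c%:M ->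
  [/\ v1 ^+ 2 + v2 ^+ 2 + v3 ^+ 2 = 1,
     [/\ s11 = t * v1 * v1, s22 = t * v2 * v2 & s33 = t * v3 * v3] &
     [/\ s12 = t * v1 * v2, s13 = t * v1 * v3 & s23 = t * v2 * v3]].
Proof.
move=> t c ASt; have /matrixP P := ASt.
have := (P 0 0, P 0 1, P 0 2, (P 1 0, P 1 1, P 1 2), (P 2 0, P 2 1, P 2 2)).
rewrite !(mxE, sum_ord3) /= !(mulr1n, mulr0n) => {P}.
move=> -[[[[p11 p12] p13] [[p21 p22] p23]] [[p31 p32] p33]].
(* Taking antisymmetric parts gives [S v = t v]; taking traces gives [trS]. *)
have Sv1 : s11 * v1 + s12 * v2 + s13 * v3 = t * v1 by rewrite /t in p23 p32 *; lra.
have Sv2 : s12 * v1 + s22 * v2 + s23 * v3 = t * v2 by rewrite /t in p13 p31 *; lra.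
have Sv3 : s13 * v1 + s23 * v2 + s33 * v3 = t * v3 by rewrite /t in p12 p21 *; lra.
have trS : s11 ^+ 2 + s22 ^+ 2 + s33 ^+ 2 + 2 * (s12 ^+ 2 + s13 ^+ 2 + s23 ^+ 2)
    - t ^+ 2 = 3 * c by rewrite /t in p11 p22 p33 *; lra.
have [c0|c0] := eqVneq c 0.
  have v1E : v1 ^+ 2 + v2 ^+ 2 + v3 ^+ 2 = 1.
    by rewrite c0 in trS; rewrite /c in c0; rewrite /t in trS; lra.
  (* [tr ((S - t v v^T)^2) = tr (S^2) - 2 t v^T S v + t^2 |v|^4 = 0]. *)
  have dist : (s11 - t * v1 * v1) ^+ 2 + (s22 - t * v2 * v2) ^+ 2
      + (s33 - t * v3 * v3) ^+ 2 + 2 * ((s12 - t * v1 * v2) ^+ 2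
      + (s13 - t * v1 * v3) ^+ 2 + (s23 - t * v2 * v3) ^+ 2) = 0.
    transitivity (s11 ^+ 2 + s22 ^+ 2 + s33 ^+ 2
      + 2 * (s12 ^+ 2 + s13 ^+ 2 + s23 ^+ 2) - t ^+ 2
      + t ^+ 2 * (1 + (v1 ^+ 2 + v2 ^+ 2 + v3 ^+ 2) ^+ 2)
      - 2 * t * (v1 * (s11 * v1 + s12 * v2 + s13 * v3)
        + v2 * (s12 * v1 + s22 * v2 + s23 * v3)
        + v3 * (s13 * v1 + s23 * v2 + s33 * v3))); first ring.
    rewrite trS c0 Sv1 Sv2 Sv3.
    transitivity (t ^+ 2 * (1 - (v1 ^+ 2 + v2 ^+ 2 + v3 ^+ 2)) ^+ 2); first ring.
    by rewrite v1E; ring.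
  have [[d1 d2 d3] [d4 d5 d6]] := symmetric_norm_eq0 dist.
  by split=> //; split; apply/eqP; rewrite -subr_eq0; apply/eqP.
(* Otherwise [c v = (A - t) S v = t (A - t) v = 0], so [A = S], and the
   adjugate of [S] is [S^2 - t S - 3 = -1], which no real matrix satisfies. *)
have [v10 v20 v30] : [/\ v1 = 0, v2 = 0 & v3 = 0].
  apply: col3_eq0; apply/eqP.
  suff : c *: col3 v1 v2 v3 == 0 by rewrite scaler_eq0 (negPf c0).
  apply/eqP; rewrite -mul_scalar_mx -ASt -mulmxA !mul_mat3_col3 Sv1 Sv2 Sv3.
  apply: col3P; rewrite !mxE /=.
  - transitivity (t * ((s11 * v1 + s12 * v2 + s13 * v3) - t * v1)); first ring.
    by rewrite Sv1; ring.
  - transitivity (t * ((s12 * v1 + s22 * v2 + s23 * v3) - t * v2)); first ring.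
    by rewrite Sv2; ring.
  - transitivity (t * ((s13 * v1 + s23 * v2 + s33 * v3) - t * v3)); first ring.
    by rewrite Sv3; ring.
(* Now [trS] reads [- 2 s2 = 3 c], while [2 c = 1 - s2]; hence [c = 2] and [s2 = -3]. *)
have c2 : c = 2 by rewrite /t in trS; rewrite /c v10 v20 v30 in trS *; lra.
have c2' := c2; rewrite /c v10 v20 v30 in c2'.
rewrite {}c2 ?v10 ?v20 ?v30 /t in p11 p12 p13 p22 p23 p33.
have adj11 : s22 * s33 - s23 ^+ 2 = -1 by lra.
have adj22 : s11 * s33 - s13 ^+ 2 = -1 by lra.
have adj33 : s11 * s22 - s12 ^+ 2 = -1 by lra.
have adj12 : s13 * s23 - s12 * s33 = 0 by lra.
have adj13 : s12 * s23 - s13 * s22 = 0 by lra.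
have adj23 : s12 * s13 - s11 * s23 = 0 by lra.
(* Off-diagonal entries of [S adj S = det S] vanish; with [adj S = -1] this gives [s12 = 0], then
   [s13 = 0]. *)
have s120 : s12 = 0.
  transitivity (- (s11 * (s13 * s23 - s12 * s33) + s12 * (s11 * s33 - s13 ^+ 2)
    + s13 * (s12 * s13 - s11 * s23))); last ring.
  by rewrite adj12 adj22 adj23; ring.
have s130 : s13 = 0.
  transitivity (- (s11 * (s12 * s23 - s13 * s22) + s12 * (s12 * s13 - s11 * s23)
    + s13 * (s11 * s22 - s12 ^+ 2))); last ring.
  by rewrite adj13 adj23 adj33; ring.
rewrite s120 s130 in adj22 adj33 adj23.
have s11N1 : s11 ^+ 2 = -1.
  have : (s11 * s22 - 0 ^+ 2) * (s11 * s33 - 0 ^+ 2) =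
      s11 ^+ 2 * (s22 * s33 - s23 ^+ 2) + (0 * 0 - s11 * s23) ^+ 2 by ring.
  by rewrite adj11 adj22 adj33 adj23; lra.
by have := sqr_ge0 s11; rewrite s11N1; lra.
Qed.

(** After splitting [A] into symmetric and antisymmetric parts, the torsion at the three pairs of
    basis vectors yields, by linear combination, the matrix equation of [sym_antisym_eq]. *)
Lemma su2_torsion_vector A : zero_torsion (@su2_bracket R) (mulmx A) ->
  exists t v1 v2 v3 : R, v1 ^+ 2 + v2 ^+ 2 + v3 ^+ 2 = 1 /\
    A = mat3 (t * v1 * v1) (t * v1 * v2 + v3) (t * v1 * v3 - v2)
             (t * v1 * v2 - v3) (t * v2 * v2) (t * v2 * v3 + v1)
             (t * v1 * v3 + v2) (t * v2 * v3 - v1) (t * v3 * v3).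
Proof.
have [s11 [s22 [s33 [s12 [s13 [s23 [v1 [v2 [v3 ->]]]]]]]]] :
    exists s11 s22 s33 s12 s13 s23 v1 v2 v3 : R,
    A = mat3 s11 (s12 + v3) (s13 - v2) (s12 - v3) s22 (s23 + v1)
             (s13 + v2) (s23 - v1) s33.
  exists (A 0 0), (A 1 1), (A 2 2), ((A 0 1 + A 1 0) / 2),
    ((A 0 2 + A 2 0) / 2), ((A 1 2 + A 2 1) / 2), ((A 1 2 - A 2 1) / 2),
    ((A 2 0 - A 0 2) / 2), ((A 0 1 - A 1 0) / 2).
  by apply: mat3P; apply: ord3P; split; rewrite !mxE /=; lra.
move=> TA.
have := TA (col3 0 1 0) (col3 0 0 1); have := TA (col3 0 0 1) (col3 1 0 0).
have := TA (col3 1 0 0) (col3 0 1 0).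
rewrite !mul_mat3_col3 !su2_bracket_col3 !mul_mat3_col3 !col3B.
do 3 move=> /col3_eq0 [? ? ?].
have [v1E [e11 e22 e33] [e12 e13 e23]] :
  [/\ v1 ^+ 2 + v2 ^+ 2 + v3 ^+ 2 = 1,
     [/\ s11 = (s11 + s22 + s33) * v1 * v1, s22 = (s11 + s22 + s33) * v2 * v2
       & s33 = (s11 + s22 + s33) * v3 * v3] &
     [/\ s12 = (s11 + s22 + s33) * v1 * v2, s13 = (s11 + s22 + s33) * v1 * v3
       & s23 = (s11 + s22 + s33) * v2 * v3]].
  apply: sym_antisym_eq; apply: mat3P; apply: ord3P;
    split; rewrite !(mxE, sum_ord3) /=; lra.
by exists (s11 + s22 + s33), v1, v2, v3; split; rewrite // -e11 -e22 -e33 -e12 -e13 -e23.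
Qed.

(** The map [A] is built from [v], the inner product and the cross product, so conjugation by a
    rotation taking [e3] to [v] replaces [v] by [e3]. *)
Lemma su2_torsion_normal_form A : zero_torsion (@su2_bracket R) (mulmx A) ->
  exists (Phi : 'M[R]_3) (t : R),
    is_SO Phi /\ Phi^T *m A *m Phi = mat3 0 1 0 (-1) 0 0 0 0 t.
Proof.
move=> /su2_torsion_vector [t [v1 [v2 [v3 [v1E AE]]]]].
have [Phi SPhi PhiE] := SO_of_unit_vector v1E.
exists Phi, t; split=> //.
pose v := col3 v1 v2 v3; pose e3 : 'cV[R]_3 := delta_mx 2 0.
have PhiTv : Phi^T *m v = e3 by rewrite /v -PhiE mulmxA SPhi.1 mul1mx.
have Ax x : A *m x = t *: (v *m (v^T *m x)) - su2_bracket v x.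
  by apply: col3P; rewrite AE !(mxE, sum_ord3, big_ord1, ord3D) /=; ring.
have ATx x : (Phi^T *m A *m Phi) *m x = t *: (e3 *m (e3^T *m x)) - su2_bracket e3 x.
  rewrite -!mulmxA Ax mulmxBr -scalemxAr (mulmxA _ v) PhiTv.
  rewrite -[v]PhiE trmx_mul -!mulmxA (mulmxA Phi^T) SPhi.1 mul1mx.
  by rewrite SO_su2_bracket // (mulmxA Phi^T) SPhi.1 mul1mx.
move: ATx; move: (Phi^T *m A *m Phi) => B BE.
apply/matrixP=> i j.
have -> : B i j = (B *m delta_mx j (0 : 'I_1)) i 0 by rewrite -colE mxE.
rewrite BE; move: i j; apply: ord3P; apply: ord3P.
all: by rewrite !(mxE, sum_ord3, big_ord1, ord3D) /=; ring.
Qed.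

(** * The action of SO(3) x SO(3) on brackets and torsion *)

Lemma su2_bracketx0 x : su2_bracket x 0 = 0.
Proof. by rewrite su2_bracketC su2_bracket0x oppr0. Qed.

Lemma bracket_col_mx x1 x2 y1 y2 : bracket (col_mx x1 x2) (col_mx y1 y2) =
  col_mx (su2_bracket x1 y1) (su2_bracket x2 y2).
Proof. by rewrite /bracket !col_mxKu !col_mxKd. Qed.

Lemma SO3xSO3_bracket Phi (X Y : su2su2 R) : is_SO3xSO3 Phi ->
  bracket (Phi *m X) (Phi *m Y) = Phi *m bracket X Y.
Proof.
move=> [Phi1 [Phi2 [SO1 SO2 ->]]]; rewrite -[X]vsubmxK -[Y]vsubmxK.
by rewrite !(bracket_col_mx, mul_block_col) !mul0mx !addr0 !add0r !SO_su2_bracket.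
Qed.

Lemma SO_trmx n (A : 'M[R]_n) : is_SO A -> is_SO A^T.
Proof. by case=> AtA dA; split; rewrite ?det_tr // trmxK; exact: mulmx1C. Qed.

Lemma SO3xSO3_trmx Phi : is_SO3xSO3 Phi -> is_SO3xSO3 Phi^T.
Proof.
move=> [Phi1 [Phi2 [/SO_trmx SO1 /SO_trmx SO2 ->]]].
by exists Phi1^T, Phi2^T; rewrite tr_block_mx !trmx0.
Qed.

Lemma SO3xSO3_tr_mul Phi : is_SO3xSO3 Phi -> Phi^T *m Phi = 1%:M.
Proof.
move=> [Phi1 [Phi2 [[O1 _] [O2 _] ->]]].
rewrite tr_block_mx !trmx0 mulmx_block !mul0mx !mulmx0 O1 O2 !addr0 add0r.
by rewrite -scalar_mx_block.
Qed.

Lemma SO3xSO3_invmx Phi : is_SO3xSO3 Phi -> invmx Phi = Phi^T.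
Proof.
move=> SPhi; have PtP := SO3xSO3_tr_mul SPhi; have [_ uPhi] := mulmx1_unit PtP.
by rewrite -[RHS]mulmx1 -(mulmxV uPhi) mulmxA PtP mul1mx.
Qed.

(** As [Phi^T] is a bracket automorphism inverse to [Phi], the torsion of the conjugate at
    [Phi^T U], [Phi^T V] is [Phi^T] applied to that of [M] at [U], [V]. *)
Lemma zero_torsion_conj Phi M : is_SO3xSO3 Phi ->
  zero_torsion (@bracket R) (mulmx M) ->
  zero_torsion (@bracket R) (mulmx (Phi^T *m M *m Phi)).
Proof.
move=> SPhi TM X Y; have SPhit := SO3xSO3_trmx SPhi.
have PhitK (Z : su2su2 R) : Phi^T *m (Phi *m Z) = Z.
  by rewrite mulmxA SO3xSO3_tr_mul // mul1mx.
have PhiK (Z : su2su2 R) : Phi *m (Phi^T *m Z) = Z.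
  by rewrite mulmxA (mulmx1C (SO3xSO3_tr_mul SPhi)) mul1mx.
have E (Z : su2su2 R) : (Phi^T *m M *m Phi) *m (Phi^T *m Z) = Phi^T *m (M *m Z).
  by rewrite -!mulmxA PhiK.
rewrite -(PhitK X) -(PhitK Y); move: (Phi *m X) (Phi *m Y) => U V.
by rewrite !E !(SO3xSO3_bracket _ _ SPhit) !E -!mulmxBr TM mulmx0.
Qed.

(** * Torsion equations in 3x3 blocks *)

Lemma block_torsionE A B C D : zero_torsion (@bracket R) (mulmx (block_mx A B C D)) ->
  forall x1 x2 y1 y2,
    su2_bracket (A *m x1 + B *m x2) (A *m y1 + B *m y2) - su2_bracket x1 y1
    - (A *m su2_bracket (A *m x1 + B *m x2) y1 + B *m su2_bracket (C *m x1 + D *m x2) y2)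
    - (A *m su2_bracket x1 (A *m y1 + B *m y2) + B *m su2_bracket x2 (C *m y1 + D *m y2)) = 0 /\
    su2_bracket (C *m x1 + D *m x2) (C *m y1 + D *m y2) - su2_bracket x2 y2
    - (C *m su2_bracket (A *m x1 + B *m x2) y1 + D *m su2_bracket (C *m x1 + D *m x2) y2)
    - (C *m su2_bracket x1 (A *m y1 + B *m y2) + D *m su2_bracket x2 (C *m y1 + D *m y2)) = 0.
Proof.
move=> T x1 x2 y1 y2; have := T (col_mx x1 x2) (col_mx y1 y2).
rewrite (mul_block_col _ _ _ _ x1) (mul_block_col _ _ _ _ y1) !bracket_col_mx.
rewrite !mul_block_col !(opp_col_mx, add_col_mx) => /eqP.
by rewrite col_mx_eq0 => /andP[/eqP-> /eqP->].
Qed.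

(** Pairs in the first factor give the conditions on [A] and [C]; a mixed pair, whose bracket is
    zero, gives the one on [B]. *)
Lemma block_torsion A B C D :
  zero_torsion (@bracket R) (mulmx (block_mx A B C D)) ->
  [/\ zero_torsion (@su2_bracket R) (mulmx A),
      forall x y, su2_bracket (C *m x) (C *m y) =
        C *m su2_bracket (A *m x) y + C *m su2_bracket x (A *m y) &
      forall x y, su2_bracket (A *m x) (B *m y) =
        B *m su2_bracket (C *m x) y + A *m su2_bracket x (B *m y)].
Proof.
move=> /block_torsionE T; split=> x y;
  [have [+ _] := T x 0 y 0 | have [_ +] := T x 0 y 0 | have [+ _] := T x 0 0 y].
all: rewrite !(mulmx0, addr0, add0r, su2_bracketx0, su2_bracket0x, subr0) //.
all: by rewrite -addrA -opprD => /subr0_eq ->; rewrite 1?addrC.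
Qed.

(** Exchanging the two factors is an automorphism of the bracket. *)
Lemma block_torsion_swap A B C D :
  zero_torsion (@bracket R) (mulmx (block_mx A B C D)) ->
  zero_torsion (@bracket R) (mulmx (block_mx D C B A)).
Proof.
move=> /block_torsionE T X Y; rewrite -[X]vsubmxK -[Y]vsubmxK.
move: (usubmx X) (dsubmx X) (usubmx Y) (dsubmx Y) => x1 x2 y1 y2.
have := T x2 x1 y2 y1.
rewrite (mul_block_col _ _ _ _ x1) (mul_block_col _ _ _ _ y1) !bracket_col_mx.
rewrite !mul_block_col !(opp_col_mx, add_col_mx).
rewrite !(addrC (A *m _) (B *m _)) !(addrC (C *m _) (D *m _)).
by case=> -> ->; rewrite col_mx0.
Qed.

Lemma off_diagonal_eq0 (t : R) B C :
  let A := mat3 0 1 0 (-1) 0 0 0 0 t in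
  (forall x y, su2_bracket (C *m x) (C *m y) =
     C *m su2_bracket (A *m x) y + C *m su2_bracket x (A *m y)) ->
  (forall x y, su2_bracket (A *m x) (B *m y) =
     B *m su2_bracket (C *m x) y + A *m su2_bracket x (B *m y)) ->
  (forall i, C i 0 = 0 /\ C i 1 = 0) /\ (forall j, B 0 j = 0 /\ B 1 j = 0).
Proof.
move=> A TC TB.
have t1_eq0 (x : R) : (1 + t ^+ 2) * x = 0 -> x = 0.
  by move/eqP; rewrite mulf_eq0 gt_eqF ?ltr_wpDr ?sqr_ge0 // => /eqP.
have [C0 C1] : C *m col3 1 0 0 = 0 /\ C *m col3 0 1 0 = 0.
  have := TC (col3 1 0 0) (col3 0 1 0); have := TC (col3 1 0 0) (col3 0 0 1).
  have := TC (col3 0 1 0) (col3 0 0 1); rewrite (mat3_eta C).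
  move: (C 0 0) (C 0 1) (C 0 2) (C 1 0) (C 1 1) (C 1 2) (C 2 0) (C 2 1) (C 2 2).
  move=> c11 c12 c13 c21 c22 c23 c31 c32 c33.
  rewrite !mul_mat3_col3 !su2_bracket_col3 !mul_mat3_col3 !col3D.
  case/col3_inj=> p1 p2 p3; case/col3_inj=> q1 q2 q3; case/col3_inj=> r1 r2 r3.
  (* With [c1, c2, c3] the columns of [C]: [c1 * c2 = 0],
     [c1 * c3 = - c1 - t c2] and [c2 * c3 = - c2 + t c1] (cross products), to be
     paired with [c1] and [c2]. *)
  have aE : (c11 ^+ 2 + c21 ^+ 2 + c31 ^+ 2) + t * (c11 * c12 + c21 * c22 + c31 * c32) = 0.
    have := (congr1 ( *%R c11) q1, congr1 ( *%R c21) q2, congr1 ( *%R c31) q3).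
    by case=> -[]; lra.
  have mE : c11 * c12 + c21 * c22 + c31 * c32 = t * (c11 ^+ 2 + c21 ^+ 2 + c31 ^+ 2).
    have := (congr1 ( *%R c11) p1, congr1 ( *%R c21) p2, congr1 ( *%R c31) p3).
    have := (congr1 ( *%R c13) r1, congr1 ( *%R c23) r2, congr1 ( *%R c33) r3).
    by case=> -[? ? ?]; case=> -[]; lra.
  have bE : c12 ^+ 2 + c22 ^+ 2 + c32 ^+ 2 = t * (c11 * c12 + c21 * c22 + c31 * c32).
    have := (congr1 ( *%R c12) p1, congr1 ( *%R c22) p2, congr1 ( *%R c32) p3).
    by case=> -[]; lra.
  have a0 : c11 ^+ 2 + c21 ^+ 2 + c31 ^+ 2 = 0.
    by apply: t1_eq0; rewrite mulrDl mul1r -[RHS]aE mE; ring.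
  have [|[-> -> ->] [-> -> ->]] := @symmetric_norm_eq0 c11 c21 c31 c12 c22 c32.
    by rewrite bE mE a0; ring.
  by split; apply: col3P; rewrite !mxE /=; ring.
(* As [C] kills [e1] and [e2], [TB] says that [A e_i] cross [b] is [A] applied to [e_i] cross [b],
   where [b = B y] and [i = 1, 2]; third coordinates give [b1 = t b2] and [b2 = - t b1]. *)
have B0 y : (B *m y) 0 0 = 0 /\ (B *m y) 1 0 = 0.
  have := TB (col3 1 0 0) y; have := TB (col3 0 1 0) y.
  rewrite C0 C1 su2_bracket0x mulmx0 !add0r (col3_eta (B *m y)).
  move: ((B *m y) 0 0) ((B *m y) 1 0) ((B *m y) 2 0) => b1 b2 b3.
  rewrite !mul_mat3_col3 !su2_bracket_col3 !mul_mat3_col3.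
  case/col3_inj=> p1 p2 p3; case/col3_inj=> q1 q2 q3; rewrite !mxE /=.
  have b10 : b1 = 0.
    apply: t1_eq0; transitivity (b1 - t * b2 + t * (b2 + t * b1)); first ring.
    have -> : b1 - t * b2 = 0 by lra.
    have -> : b2 + t * b1 = 0 by lra.
    by ring.
  by split=> //; rewrite b10 in p3; lra.
split=> [i|j].
  have := (congr1 (fun x : 'cV_3 => x i 0) C0, congr1 (fun x : 'cV_3 => x i 0) C1).
  rewrite !(mxE, sum_ord3) /=; case; lra.
by have := B0 (delta_mx j 0); rewrite -colE !mxE.
Qed.

(** [off_diagonal_eq0] clears two columns of [C] and two rows of [B]; after the swap it clears the
    rows of [C] and the columns of [B]. *)
Lemma torsion_block_normal (s t : R) B C :
  zero_torsion (@bracket R)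
    (mulmx (block_mx (mat3 0 1 0 (-1) 0 0 0 0 s) B C (mat3 0 1 0 (-1) 0 0 0 0 t))) ->
  B = mat3 0 0 0 0 0 0 0 0 (B 2 2) /\ C = mat3 0 0 0 0 0 0 0 0 (C 2 2).
Proof.
move=> T; have [_ TC TB] := block_torsion T.
have [_ TC' TB'] := block_torsion (block_torsion_swap T).
have [C0 B0] := off_diagonal_eq0 TC TB; have [B0' C0'] := off_diagonal_eq0 TC' TB'.
split; apply: mat3P; apply: ord3P; split; rewrite !mxE //=.
all: by rewrite ?(C0 _).1 ?(C0 _).2 ?(C0' _).1 ?(C0' _).2 ?(B0 _).1 ?(B0 _).2
  ?(B0' _).1 ?(B0' _).2.
Qed.

(** * The converse, and matrices of linear maps *)

Lemma block_normal_torsion (s t b c : R) :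
  zero_torsion (@bracket R)
    (mulmx (block_mx (mat3 0 1 0 (-1) 0 0 0 0 s) (mat3 0 0 0 0 0 0 0 0 b)
                     (mat3 0 0 0 0 0 0 0 0 c) (mat3 0 1 0 (-1) 0 0 0 0 t))).
Proof.
move=> X Y; rewrite -[X]vsubmxK -[Y]vsubmxK.
rewrite (mul_block_col _ _ _ _ (usubmx X)) (mul_block_col _ _ _ _ (usubmx Y)).
rewrite !bracket_col_mx.
rewrite !mul_block_col !(opp_col_mx, add_col_mx).
rewrite (col3_eta (usubmx X)) (col3_eta (dsubmx X)).
rewrite (col3_eta (usubmx Y)) (col3_eta (dsubmx Y)).
rewrite !(mul_mat3_col3, col3D, su2_bracket_col3, col3B).
by rewrite -[RHS]col_mx0; congr col_mx; rewrite col3_0; congr col3; ring.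
Qed.

Lemma normal_form_block (s b c t : R) : normal_form s b c t =
  block_mx (mat3 0 1 0 (-1) 0 0 0 0 s) (mat3 0 0 0 0 0 0 0 0 b)
           (mat3 0 0 0 0 0 0 0 0 c) (mat3 0 1 0 (-1) 0 0 0 0 t).
Proof.
rewrite -[LHS]submxK; congr block_mx; apply: mat3P; apply: ord3P; split; by rewrite !mxE.
Qed.

Lemma matrix_ofE (f : {linear su2su2 R -> su2su2 R}) X : f X = matrix_of f *m X.
Proof.
rewrite {1}(matrix_sum_delta X) linear_sum; apply/colP=> i.
rewrite summxE mxE; apply: eq_bigr => j _.
by rewrite big_ord1 linearZ !mxE mulrC.
Qed.

End NormalForm.

Theorem theorem2 (R : realType) (J : {linear su2su2 R -> su2su2 R}) :
  zero_torsion (@bracket R) J <->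
  exists (Phi : 'M[R]_(3 + 3)) (xi_33 xi_36 xi_63 xi_66 : R),
    is_SO3xSO3 Phi /\
    invmx Phi *m matrix_of J *m Phi = normal_form xi_33 xi_36 xi_63 xi_66.
Proof.

have TE : zero_torsion (@bracket R) J <-> zero_torsion (@bracket R) (mulmx (matrix_of J)).
  by split=> T X Y; have := T X Y; rewrite !(matrix_ofE J).
rewrite TE; split=> [T | [Phi [s [b [c [t [SPhi MN]]]]]]]; last first.
  have SPhit := SO3xSO3_trmx SPhi.
  (* The matrix of [J] is the normal form conjugated by [Phi^T], written in the shape used by
     [zero_torsion_conj]. *)
  have -> : matrix_of J = Phi^T^T *m normal_form s b c t *m Phi^T.
    have PPt := mulmx1C (SO3xSO3_tr_mul SPhi).
    by rewrite trmxK -MN SO3xSO3_invmx // !mulmxA PPt mul1mx -mulmxA PPt mulmx1.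
  by rewrite normal_form_block; apply/zero_torsion_conj/block_normal_torsion.
move: (matrix_of J) T => M; rewrite -[M]submxK.
move: (ulsubmx M) (ursubmx M) (dlsubmx M) (drsubmx M) => A B C D T.
have [/su2_torsion_normal_form [Phi1 [s [SO1 AE]]] _ _] := block_torsion T.
have [/su2_torsion_normal_form [Phi2 [t [SO2 DE]]] _ _] :=
  block_torsion (block_torsion_swap T).
have SPhi : is_SO3xSO3 (block_mx Phi1 0 0 Phi2) by exists Phi1, Phi2.
have := zero_torsion_conj SPhi T.
rewrite tr_block_mx !trmx0 !mulmx_block !(mul0mx, mulmx0, add0r, addr0) AE DE.
move=> /torsion_block_normal [BE CE].
(* The mixed parameters are the only entries of the conjugated off-diagonal blocks that may
   survive. *)
exists (block_mx Phi1 0 0 Phi2), s, ((Phi1^T *m B *m Phi2) 2 2), ((Phi2^T *m C *m Phi1) 2 2), t.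
split=> //; rewrite SO3xSO3_invmx // tr_block_mx !trmx0 !mulmx_block.
by rewrite !(mul0mx, mulmx0, add0r, addr0) AE DE normal_form_block -BE -CE.
Qed.
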